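(* The map $$\Psi:\{(q,v)\in TS^3:\ 0<q_0<1\}\to(\mathbb{R}^3\setminus\{0\})\times\mathbb{R}^3,\qquad \Psi(q,v)=(\boldsymbol Q,\boldsymbol V)=\Big(\frac{\boldsymbol q}{q_0},\ \boldsymbol\pi\Big)$$ is not symplectic.
   Context: Write $q=(q_0,\boldsymbol q)$, $v=(v_0,\boldsymbol v)\in\mathbb{R}\times\mathbb{R}^3$; $TS^3=\{(q,v)\in\mathbb{R}^4\times\mathbb{R}^4:\langle q,q\rangle=1,\langle q,v\rangle=0\}$, with symplectic form the restriction of $\omega=\sum_{i=0}^3dq_i\wedge dv_i$. Here $\boldsymbol\pi=q_0\boldsymbol v-v_0\boldsymbol q$. The space $(\mathbb{R}^3\setminus\{0\})\times\mathbb{R}^3$ with coordinates $(\boldsymbol Q,\boldsymbol V)$ carries the symplectic form $\omega_3=\sum_{i=1}^3dQ_i\wedge dV_i$. *)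

(* Defs.v *)
From HB Require Import structures.
From mathcomp Require Import all_boot all_order all_algebra.
From mathcomp Require Import all_classical all_reals all_analysis.

Set Implicit Arguments.
Unset Strict Implicit.
Unset Printing Implicit Defensive.

Import Order.TTheory GRing.Theory Num.Theory.
Import numFieldNormedType.Exports.

Local Open Scope classical_set_scope.
Local Open Scope ring_scope.

Section Canonical.
Context {R : realType}.

Definition dot {n : nat} (x y : 'rV[R]_n) : R := \sum_(i < n) x 0 i * y 0 i.

(* The constant 2-form \sum_i d x_i /\ d y_i on R^n x R^n. *)
Definition canonical_form {n : nat} (u w : 'rV[R]_n * 'rV[R]_n) : R :=
  \sum_(i < n) (u.1 0 i * w.2 0 i - w.1 0 i * u.2 0 i).

(* Velocities at p of curves lying in M. *)
Definition tangent_space {E : normedModType R} (M : set E) (p : E) : set E :=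
  [set u | exists c : R -> E,
     [/\ c 0 = p, \forall t \near 0, M (c t) & is_derive (0 : R) 1 c u]].

(* f^* omega_N = omega_M on M, the forms being constant in the ambient spaces
   and evaluated on vectors tangent to M. The differential is that of f as a
   function on E, so it is meaningful only if f is differentiable in E at the
   points of M (for Psi below, see differentiable_Psi). *)
Definition symplectic_map {E F : normedModType R} {M : set E} {N : set F}
    (omegaM : E -> E -> R) (omegaN : F -> F -> R) (f : {fun M >-> N}) : Prop :=
  forall p u w : E, M p -> tangent_space M p u -> tangent_space M p w ->
    omegaN ('d f p u) ('d f p w) = omegaM u w.

End Canonical.

Section Psi.
Context (R : realType).

(* For q = (q_0, bold q) in R^4, q_0 is q 0 0 and bold q is col' 0 q. *)

Definition TS3 : set ('rV[R]_4 * 'rV[R]_4) :=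
  [set x | dot x.1 x.1 = 1 /\ dot x.1 x.2 = 0].

Definition PsiDom : set ('rV[R]_4 * 'rV[R]_4) :=
  [set x | TS3 x /\ 0 < x.1 0 0 < 1].

Definition PsiCod : set ('rV[R]_3 * 'rV[R]_3) := [set y | y.1 != 0].

Definition bold_pi (q v : 'rV[R]_4) : 'rV[R]_3 :=
  q 0 0 *: col' 0 v - v 0 0 *: col' 0 q.

Definition Psi (x : 'rV[R]_4 * 'rV[R]_4) : 'rV[R]_3 * 'rV[R]_3 :=
  ((x.1 0 0)^-1 *: col' 0 x.1, bold_pi x.1 x.2).

Fact Psi_fun : set_fun PsiDom PsiCod Psi.
Proof.
move=> [q v] [[/= qq _] /andP[q0 q1]] /=; apply/eqP => Q0.
move: Q0 => /eqP; rewrite scaler_eq0 invr_eq0 (gt_eqF q0) /= => /eqP col0.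
move: qq; rewrite /dot big_ord_recl big1 => [|i _].
  rewrite addr0 => qq; have : q 0 0 * q 0 0 < 1 by rewrite mulr_ilt1 // ltW.
  by rewrite qq ltxx.
by move/rowP: col0 => /(_ i); rewrite !mxE => ->; rewrite mul0r.
Qed.

HB.instance Definition _ := isFun.Build _ _ PsiDom PsiCod Psi Psi_fun.

Fact differentiable_row {V : normedModType R} {n : nat} (f : V -> 'rV[R]_n) x :
  (forall i, differentiable (fun y => f y 0 i) x) -> differentiable f x.
Proof.
move=> df.
have -> : f = \sum_(i < n) (fun y => f y 0 i *: delta_mx 0 i).
  by apply/funext => y; rewrite fct_sumE -row_sum_delta.
by apply: differentiable_sum => i; exact: differentiableZl.
Qed.

Fact differentiable_Psi x : PsiDom x -> differentiable Psi x.
Proof.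
move=> [_ /andP[q0 _]].
have dq i : differentiable (fun y : 'rV[R]_4 * 'rV[R]_4 => y.1 0 i) x.
  apply: (@differentiable_comp _ _ _ _ fst (fun q : 'rV[R]_4 => q 0 i)).
  - by apply: (@linear_differentiable _ _ _ fst) => z; exact: cvg_fst.
  - exact: differentiable_coord.
have dv i : differentiable (fun y : 'rV[R]_4 * 'rV[R]_4 => y.2 0 i) x.
  apply: (@differentiable_comp _ _ _ _ snd (fun q : 'rV[R]_4 => q 0 i)).
  - by apply: (@linear_differentiable _ _ _ snd) => z; exact: cvg_snd.
  - exact: differentiable_coord.
apply: differentiable_pair; apply: differentiable_row => i.
  under eq_fun do rewrite !mxE.
  apply: differentiableM => //; apply: differentiableV => //.
  by rewrite gt_eqF.
under eq_fun do rewrite !mxE.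
by apply: differentiableB; exact: differentiableM.
Qed.

End Psi.

Arguments TS3 R : clear implicits.
Arguments PsiDom R : clear implicits.
Arguments PsiCod R : clear implicits.

(* Main.v *)
Require Import Defs.
From mathcomp Require Import all_boot all_order all_algebra.
From mathcomp Require Import all_classical all_reals all_analysis.
From mathcomp Require Import ring lra.

Set Implicit Arguments.
Unset Strict Implicit.
Unset Printing Implicit Defensive.

Import Order.TTheory GRing.Theory Num.Theory.
Import numFieldNormedType.Exports.

Local Open Scope classical_set_scope.
Local Open Scope ring_scope.

(** The tautological one-forms explain the failure. On [TS3], where
    [<bold q, bold v> = - q_0 v_0] and [<bold q, d bold q> = - q_0 dq_0],
    expanding [<V, dQ>] gives
    [[ Psi^* <V, dQ> = <v, dq> + (v_0 / q_0^2) dq_0, ]]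
    so [Psi^* omega_3] differs from [omega] by a nonzero multiple of
    [dq_0 /\ dv_0].

    It is enough to see this defect at a point [(q, 0)] of the zero section,
    on the pair formed by a horizontal vector [(u, 0)] and a vertical vector
    [(0, z)], with [u] and [z] orthogonal to [q]: there [omega] takes the value
    [<u, z>] and [Psi^* omega_3] the value [<u, z> + u_0 z_0 / q_0^2]
    ([pullback_zero_section]). Such vectors are tangent to the domain, being
    velocities of a great circle ([tangent_great_circle]) and of a line in the
    fibre over [q] ([tangent_fibre]). As [Psi] is differentiable, its
    differential can be computed along straight lines of the ambient space
    ([diff_along_line]); [bold pi] is bilinear and [bold q / q_0] is a
    quotient, which makes both restrictions to lines explicit. *)

Section Calculus.
Context {R : realType}.

Lemma is_derive_scalel {V : normedModType R} (k : R -> R) (x dk : R) (X : V) :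
  is_derive x 1 k dk -> is_derive x 1 (fun t => k t *: X) (dk *: X).
Proof.
move=> kx.
have cv :
    h^-1 *: (k (h *: 1 + x) *: X - k x *: X) @[h --> 0^'] --> dk *: X.
  under eq_fun do rewrite -scalerBl scalerA.
  apply: (@cvgZr_tmp R V _ _ _ (fun h => h^-1 * (k (h *: 1 + x) - k x)) dk X).
  have kd : derivable k x 1 by exact: ex_derive.
  by rewrite -(@derive_val _ _ _ _ _ _ _ kx).
by apply: DeriveDef; [apply: cvgP cv | apply: cvg_lim cv].
Qed.

(** This applies to a vector [u] tangent to a subset of [E] even when the line
    through [p] directed by [u] leaves that subset: as [f] is differentiable in
    the ambient space, its differential at [u] does not depend on the curve of
    which [u] is the velocity. *)
Lemma diff_along_line {E F : normedModType R} (f : E -> F) (p u : E) (l : F) :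
  differentiable f p -> is_derive (0 : R) 1 (fun h => f (h *: u + p)) l ->
  'd f p u = l.
Proof.
move=> fp fl; rewrite -deriveE // -(@derive_val _ _ _ _ _ _ _ fl) /derive.
under [in RHS]eq_fun do rewrite /= scale0r add0r addr0 [_ *: 1]mulr1.
by [].
Qed.

End Calculus.

Section ZeroSection.
Context {R : realType}.
Implicit Types q v u z : 'rV[R]_4.

Lemma dotDl {n} (x y w : 'rV[R]_n) : dot (x + y) w = dot x w + dot y w.
Proof. by rewrite -big_split; apply: eq_bigr => i _; rewrite mxE mulrDl. Qed.

Lemma dotZl {n} a (x w : 'rV[R]_n) : dot (a *: x) w = a * dot x w.
Proof. by rewrite mulr_sumr; apply: eq_bigr => i _; rewrite mxE mulrA. Qed.

Lemma dotNl {n} (x w : 'rV[R]_n) : dot (- x) w = - dot x w.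
Proof. by rewrite -scaleN1r dotZl mulN1r. Qed.

Lemma dotC {n} (x y : 'rV[R]_n) : dot x y = dot y x.
Proof. by apply: eq_bigr => i _; rewrite mulrC. Qed.

Lemma dot0r {n} (x : 'rV[R]_n) : dot x 0 = 0.
Proof. by apply: big1 => i _; rewrite mxE mulr0. Qed.

(** The great circle [cos t q + sin t u], with zero second component, stays in
    [TS3] by Pythagoras and in the open condition on [q_0] for small [t]. *)
Lemma tangent_great_circle q u :
    dot q q = 1 -> dot u u = 1 -> dot q u = 0 -> 0 < q 0 0 < 1 ->
  tangent_space (PsiDom R) (q, 0) (u, 0).
Proof.
move=> qq uu qu q01.
exists (fun t => cos t *: (q, 0) + sin t *: (u, 0)); split.
- by rewrite cos0 sin0 scale1r scale0r addr0.
- have c0 : (cos t * q 0 0 + sin t * u 0 0) @[t --> (0 : R)] --> q 0 0.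
    have {2}-> : q 0 0 = cos 0 * q 0 0 + sin 0 * u 0 0.
      by rewrite cos0 sin0; ring.
    by apply: cvgD; apply: cvgMl; [exact: continuous_cos | exact: continuous_sin].
  have /andP[q0 q1] := q01.
  near=> t.
  split; last first.
    rewrite /= !mxE; apply/andP; split; near: t.
      exact: cvgr_gt q0.
    exact: cvgr_lt q1.
  split; rewrite /= ?scaler0 ?addr0 ?dot0r //.
  rewrite !(dotDl, dotZl, dotC _ (_ + _)) (dotC u q) qq uu qu -[RHS](cos2Dsin2 t).
  ring.
- apply: is_derive_eq.
    by apply: is_deriveD; apply: is_derive_scalel.
  by rewrite sin0 cos0 oppr0 scale0r scale1r add0r.
Unshelve. all: by end_near. Qed.

(** The fibre of [TS3] over [q] is a linear space, so that it contains the line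
    directed by [z]; the base point, hence [q_0], does not move along it. *)
Lemma tangent_fibre q z :
    dot q q = 1 -> dot q z = 0 -> 0 < q 0 0 < 1 ->
  tangent_space (PsiDom R) (q, 0) (0, z).
Proof.
move=> qq qz q01; exists (fun t => (q, 0) + t *: (0, z)); split.
- by rewrite scale0r addr0.
- near=> t; rewrite /PsiDom /TS3 /= scaler0 addr0 add0r; split => //.
  by split => //; rewrite dotC dotZl dotC qz mulr0.
- apply: is_derive_eq.
    by apply: is_deriveD; apply: is_derive_scalel.
  by rewrite scale1r add0r.
Unshelve. all: by end_near. Qed.

Lemma diff_Psi_horizontal q u : PsiDom R (q, 0) ->
  'd (@Psi R) (q, 0) (u, 0) =
    ((q 0 0)^-1 *: col' 0 u - (u 0 0 / q 0 0 ^+ 2) *: col' 0 q, 0).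
Proof.
move=> D; have := D => -[_ /andP[/= q0 _]].
apply: diff_along_line; first exact: differentiable_Psi.
(* Separating scalar functions from constant vectors reduces the derivative to
   that of real functions. *)
have -> : (fun h : R => Psi (h *: (u, 0) + (q, 0))) =
    (fun h : R => (h * u 0 0 + q 0 0)^-1 *: (col' 0 q, 0) +
         (h * (h * u 0 0 + q 0 0)^-1) *: (col' 0 u, 0)).
  apply/funext => h; rewrite /Psi /bold_pi /=; congr pair.
    by apply/rowP => i; rewrite !mxE; ring.
  by apply/rowP => i; rewrite !mxE; ring.
have da : is_derive (0 : R) 1 (fun h : R => h * u 0 0 + q 0 0) (u 0 0).
  by apply: is_derive_eq; rewrite scaler0 add0r addr0 [_ *: 1]mulr1.
have dV : is_derive (0 : R) 1 (fun h : R => (h * u 0 0 + q 0 0)^-1)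
    (- (u 0 0 / q 0 0 ^+ 2)).
  apply: (is_derive_eq (is_deriveV _ da)); first by rewrite mul0r add0r gt_eqF.
  by rewrite mul0r add0r /GRing.scale /=; ring.
apply: is_derive_eq.
  by apply: is_deriveD; apply: is_derive_scalel.
rewrite /= scale0r mul0r !add0r [_%:A]mulr1 addrC.
by congr pair; rewrite /= ?scaler0 ?addr0 ?scaleNr.
Qed.

(** [bold_pi] is bilinear and the first component of [Psi] ignores velocities,
    so [Psi] is affine on each fibre. *)
Lemma diff_Psi_vertical q v z : PsiDom R (q, v) ->
  'd (@Psi R) (q, v) (0, z) = (0, bold_pi q z).
Proof.
move=> D; apply: diff_along_line; first exact: differentiable_Psi.
have -> : (fun h : R => Psi (h *: (0, z) + (q, v))) =
    (fun h : R => Psi (q, v) + h *: (0, bold_pi q z)).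
  apply/funext => h; rewrite /Psi /bold_pi /=; congr pair.
    by apply/rowP => i; rewrite !mxE mulr0 !add0r addr0.
  by apply/rowP => i; rewrite !mxE; ring.
apply: is_derive_eq.
  by apply: is_deriveD; apply: is_derive_scalel.
by rewrite add0r scale1r.
Qed.

Lemma dot_col' q u : dot (col' 0 q) (col' 0 u) = dot q u - q 0 0 * u 0 0.
Proof.
rewrite /dot [in RHS]big_ord_recl addrC addKr.
by apply: eq_bigr => i _; rewrite !mxE.
Qed.

Lemma canonical_form_horizontal_vertical {n} (x y : 'rV[R]_n) :
  canonical_form (x, 0) (0, y) = dot x y.
Proof. by apply: eq_bigr => i _; rewrite /= !mxE mul0r subr0. Qed.

(** The term [u_0 z_0 / q_0^2] is the defect of symplecticity: by
    [canonical_form_horizontal_vertical], [omega] itself gives [dot u z]. It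
    comes from trading the products of spatial parts for products in four
    dimensions, with [q] of norm one and orthogonal to [u] and [z]. *)
Lemma pullback_zero_section q u z :
    PsiDom R (q, 0) -> dot q u = 0 -> dot q z = 0 ->
  canonical_form ('d (@Psi R) (q, 0) (u, 0)) ('d (@Psi R) (q, 0) (0, z)) =
    dot u z + u 0 0 * z 0 0 / q 0 0 ^+ 2.
Proof.
move=> D qu qz; have := D => -[[/= qq _] /andP[q0 _]].
rewrite diff_Psi_horizontal // diff_Psi_vertical //.
rewrite canonical_form_horizontal_vertical /bold_pi.
rewrite !(dotDl, dotNl, dotZl, dotC _ (_ + _)) !dot_col' (dotC z) !(dotC _ q).
rewrite qq qu qz.
by field; rewrite gt_eqF.
Qed.

End ZeroSection.

Theorem proposition6p3 (R : realType) :
  ~ symplectic_map canonical_form canonical_form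
      (@Psi R : {fun PsiDom R >-> PsiCod R}).
Proof.
(* Any rational point of the unit circle with both coordinates positive will do, its
   quarter-turn serving as both horizontal and vertical direction; the defect
   is then [(u_0 / q_0)^2 = 16 / 9]. *)
pose q : 'rV[R]_4 := \row_i [:: 3 / 5; 4 / 5; 0; 0]`_i.
pose u : 'rV[R]_4 := \row_i [:: - (4 / 5); 3 / 5; 0; 0]`_i.
have qq : dot q q = 1 by rewrite /dot !big_ord_recl big_ord0 !mxE /=; field.
have uu : dot u u = 1 by rewrite /dot !big_ord_recl big_ord0 !mxE /=; field.
have qu : dot q u = 0 by rewrite /dot !big_ord_recl big_ord0 !mxE /=; field.
have q01 : 0 < q 0 0 < 1 by rewrite mxE /=; lra.
have D : PsiDom R (q, 0) by split => //; split => //; rewrite dot0r.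
move=> /(_ (q, 0) (u, 0) (0, u) D).
move=> /(_ (tangent_great_circle qq uu qu q01) (tangent_fibre qq qu q01)).
rewrite pullback_zero_section // canonical_form_horizontal_vertical.
by rewrite !mxE /=; lra.
Qed.
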